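(* Let $\mathbb{F}$ be a field of characteristic $2$ and let $n=2$. Let $\Delta_1$ and $\Delta_2$ be the polar space and the dual polar space associated to a non-singular quadratic form $q$ of Witt index $2$ on $V=V(5,\mathbb{F})$. Let $\iota_1$ be the map sending every point $X$ of $\Delta_1$ to the nucleus $n_{l_X}$ of the conic $\varepsilon_2^{\mathrm{vs}}(l_X)$, where $l_X$ is the line of $\Delta_2$ corresponding to $X$, and let $\mathcal{N}_2$ be the subspace spanned by all these nuclei. Then $\iota_1$, as a map from $\Delta_1$ to $\mathcal{N}_2$, is a projective embedding of $\Delta_1$ isomorphic to $\tilde{\varepsilon}_1$ $(\cong\varepsilon_1^{\mathrm{gr}})$, the natural embedding of $\Delta_1$ as the quadric $q=0$ in $\mathrm{PG}(V)=\mathrm{PG}(4,\mathbb{F})$.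
   Context: $V(m,\mathbb{F})$ denotes an $m$-dimensional vector space over $\mathbb{F}$. Embeddings. A projective embedding of a point-line geometry $\Gamma=(\mathcal{P},\mathcal{L})$ in a vector space $W$ is an injective map $\varepsilon$ from $\mathcal{P}$ to the set of 1-dimensional subspaces of $W$ (points of $\mathrm{PG}(W)$) mapping every line of $\Gamma$ onto a line of $\mathrm{PG}(W)$ and with $\varepsilon(\mathcal{P})$ spanning $W$. Embeddings $\varepsilon_1:\Gamma\to W_1$, $\varepsilon_2:\Gamma\to W_2$ are isomorphic if there is a bijective semilinear map $f:W_1\to W_2$ with $\varepsilon_2=f\circ\varepsilon_1$. Geometry. $q$ is a non-singular quadratic form of Witt index 2 on $V=V(5,\mathbb{F})$ ($V$ is the orthogonal sum of two hyperbolic planes and a 1-space on which $q$ does not vanish). $\Delta_1$ has as points the 1-dimensional totally singular subspaces of $V$ and as lines the 2-dimensional totally singular subspaces (with containment as incidence). $\Delta_2$ has as points the 2-dimensional totally singular subspaces and as lines the sets $l_X=\{Z\supset X:\dim Z=2,\ Z\text{ totally singular}\}$ for $X$ a 1-dimensional totally singular subspace. The embedding $\varepsilon_1^{\mathrm{gr}}=\tilde{\varepsilon}_1$ of $\Delta_1$ in $V$ is the natural one, mapping every totally singular 1-space to itself as a point of $\mathrm{PG}(V)$. Veronesean-spin embedding. The spin embedding $\varepsilon_2^{\mathrm{spin}}:\Delta_2\to V(4,\mathbb{F})$ is the embedding of $\Delta_2$ in the spin module of $\mathrm{Spin}(5,\mathbb{F})\cong\mathrm{Sp}(4,\mathbb{F})$;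 it realizes $\Delta_2$ as the symplectic generalized quadrangle $W(3,\mathbb{F})$ whose points are all points of $\mathrm{PG}(3,\mathbb{F})$ and whose lines are the lines of $\mathrm{PG}(3,\mathbb F)$ totally isotropic for a non-degenerate alternating form on $V(4,\mathbb{F})$. Let $\nu_4:V(4,\mathbb{F})\to V(10,\mathbb{F})$ be the quadric veronesean map $(x_1,\dots,x_4)\mapsto(x_ix_j)_{1\le i\le j\le4}$. Then $\varepsilon_2^{\mathrm{vs}}:=\nu_4\circ\varepsilon_2^{\mathrm{spin}}$; it maps every line of $\Delta_2$ onto a non-singular conic. The nucleus of a non-singular conic in characteristic 2 is the point common to all its tangent lines. *)

(* Defs.v *)
From HB Require Import structures.
From mathcomp Require Import all_boot all_order all_algebra.
From mathcomp Require Import boolp classical_sets functions.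

Set Implicit Arguments.
Unset Strict Implicit.
Unset Printing Implicit Defensive.

Import GRing.Theory.
Local Open Scope classical_set_scope.
Local Open Scope ring_scope.

(** Point-line geometries: a line is identified with its set of points. *)

Record geometry := Geometry {
  carrier : Type;
  points : set carrier;
  lines : set (set carrier) }.

Arguments points : clear implicits.
Arguments lines : clear implicits.

Section ProjectiveSpaces.
Variables (F : fieldType) (W : vectType F).
Implicit Types (A : set {vspace W}) (L : {vspace W}).

Definition proj_points L : set {vspace W} :=
  [set p | \dim p = 1%N /\ (p <= L)%VS].

Definition PG : geometry := {|
  carrier := {vspace W};
  points := proj_points fullv;
  lines := [set l | exists2 L, \dim L = 2 & l = proj_points L] |}.

Definition is_span A (U : {vspace W}) : Prop :=
  (forall p, A p -> (p <= U)%VS) /\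
  (forall U', (forall p, A p -> (p <= U')%VS) -> (U <= U')%VS).

Definition span_of A : {vspace W} := xget 0%VS (is_span A).

(* For a non-singular conic [A], the lines of the plane of [A] that meet [A]
   in exactly one point are its tangent lines, over every field. *)
Definition tangent_line A L : Prop :=
  [/\ \dim L = 2, (L <= span_of A)%VS
    & exists p, A `&` proj_points L = [set p]].

Definition is_nucleus A (n : {vspace W}) : Prop :=
  [set p | \dim p = 1%N /\ forall L, tangent_line A L -> (p <= L)%VS] = [set n].

(* The default [0] is not a point of [PG], so it cannot pass for a nucleus. *)
Definition nucleus A : {vspace W} := xget 0%VS (is_nucleus A).

End ProjectiveSpaces.

Arguments PG {F} W.

Section Embeddings.
Variable F : fieldType.

Definition projective_embedding (G : geometry) (W : vectType F)
    (eps : carrier G -> {vspace W}) : Prop :=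
  [/\ forall p, points G p -> points (PG W) (eps p),
      set_inj (points G) eps,
      forall l, lines G l -> lines (PG W) (eps @` l)
    & span_of (eps @` points G) = fullv].

(* The companion [sigma] is an automorphism of [F], not merely an
   endomorphism. *)
Definition semilinear_bij (W1 W2 : vectType F) (f : W1 -> W2) : Prop :=
  bijective f /\
  exists2 sigma : {rmorphism F -> F},
    bijective sigma & linear_for (sigma \; *:%R) f.

Definition isomorphic_embeddings (G : geometry) (W1 W2 : vectType F)
    (eps1 : carrier G -> {vspace W1}) (eps2 : carrier G -> {vspace W2}) : Prop :=
  exists2 f : W1 -> W2, semilinear_bij f &
    forall p, points G p -> [set` eps2 p] = f @` [set` eps1 p].

(* A subspace of [N <= W], seen as a subspace of the vector space [N]. *)
Definition corestrict (W : vectType F) (N U : {vspace W}) :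
  {vspace subvs_of N} := (linfun (@vsval F W N) @^-1: U)%VS.

End Embeddings.

Section QuadraticForms.
Variables (F : fieldType) (V : vectType F) (q : V -> F).

Definition polar (u v : V) : F := q (u + v) - q u - q v.

(* [polar] is symmetric, so linearity on one side is enough. *)
Definition quadratic_form : Prop :=
  (forall a v, q (a *: v) = a ^+ 2 * q v) /\ (forall u, scalar (polar u)).

(* In characteristic 2 the radical of [polar] may be nonzero (it always is in
   odd dimension): [q] is only required not to vanish on its nonzero vectors. *)
Definition nonsingular : Prop :=
  forall v, v != 0 -> (forall u, polar v u = 0) -> q v != 0.

Definition totally_singular (U : {vspace V}) : Prop :=
  forall v, v \in U -> q v = 0.

Definition witt_index (n : nat) : Prop :=
  (exists2 U, totally_singular U & \dim U = n) /\
  (forall U, totally_singular U -> (\dim U <= n)%N).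

Definition ts_space (k : nat) : set {vspace V} :=
  [set U | \dim U = k /\ totally_singular U].

Definition Delta1 : geometry := {|
  carrier := {vspace V};
  points := ts_space 1;
  lines := [set l | exists2 Z, ts_space 2 Z &
                      l = [set X | ts_space 1 X /\ (X <= Z)%VS]] |}.

Definition line_at (X : {vspace V}) : set {vspace V} :=
  [set Z | ts_space 2 Z /\ (X <= Z)%VS].

Definition Delta2 : geometry := {|
  carrier := {vspace V};
  points := ts_space 2;
  lines := [set l | exists2 X, ts_space 1 X & l = line_at X] |}.

Definition natural_embedding : carrier Delta1 -> {vspace V} := id.

(* [rho u v] is the action of the product [u v] of the even Clifford algebra
   [C_0(V, q)] on ['cV[F]_4].  As an algebra, [C_0(V, q)] is generated by the
   products [u v], subject to bilinearity and to the relations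
   [v v = q v] and [(u v) (v w) = q v (u w)]; hence these are exactly the
   4-dimensional [C_0(V, q)]-modules.  When [q] is non-singular of Witt index 2
   on a 5-dimensional [V], [C_0(V, q)] is isomorphic to ['M[F]_4], so such a
   module exists and is unique up to isomorphism: it is the spin module, on
   which [Spin(V, q)], a subgroup of the units of [C_0(V, q)], acts by
   restriction. *)
Definition spin_module (rho : {bilinear V -> V -> 'M[F]_4}) : Prop :=
  (forall v, rho v v = (q v)%:M) /\
  (forall u v w, rho u v *m rho v w = q v *: rho u w).

End QuadraticForms.

Arguments natural_embedding {F V} q X : rename.

Section SpinEmbedding.
Variables (F : fieldType) (V : vectType F) (q : V -> F).
Variable rho : {bilinear V -> V -> 'M[F]_4}.

(* The pure spinors of [Z]: the vectors [s] with [u s = 0] for all [u] in [Z],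
   i.e. [(v u) s = 0] for all [v] in [V] and [u] in [Z] (multiply by a
   non-singular [v]).  For [Z] a maximal totally singular subspace they form
   the point of [PG(3, F)] representing [Z]. *)
Definition spin_embedding (Z : carrier (Delta2 q)) : {vspace 'cV[F]_4} :=
  (\bigcap_(v <- vbasis (fullv : {vspace V})) \bigcap_(u <- vbasis Z)
     lker (linfun (mulmx (rho v u) : 'cV[F]_4 -> 'cV[F]_4)))%VS.

End SpinEmbedding.

Arguments spin_embedding {F V} q rho Z.

Section Veronesean.
Variable F : fieldType.

(* The 10 coordinates of [V(10, F)] are indexed by the pairs [i <= j]. *)
Definition ver_index := {ij : 'I_4 * 'I_4 | (ij.1 <= ij.2)%N}.
Definition ver_space : vectType F := {ffun ver_index -> F^o}.

Definition veronese (x : 'cV[F]_4) : ver_space :=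
  [ffun ij : ver_index => x (val ij).1 0 * x (val ij).2 0].

(* [veronese (a *: x) = a ^+ 2 *: veronese x], so the point does not depend on
   the representative. *)
Definition veronese_point (p : {vspace 'cV[F]_4}) : {vspace ver_space} :=
  <[veronese (vpick p)]>%VS.

End Veronesean.

Section Iota.
Variables (F : fieldType) (V : vectType F) (q : V -> F).
Variable rho : {bilinear V -> V -> 'M[F]_4}.

Definition vs_embedding (Z : carrier (Delta2 q)) : {vspace ver_space F} :=
  veronese_point (spin_embedding q rho Z).

Definition conic_nucleus (X : carrier (Delta1 q)) : {vspace ver_space F} :=
  nucleus (vs_embedding @` line_at q X).

Definition nuclei_span : {vspace ver_space F} :=
  span_of (conic_nucleus @` points (Delta1 q)).

Definition iota1 (X : carrier (Delta1 q)) : {vspace subvs_of nuclei_span} :=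
  corestrict nuclei_span (conic_nucleus X).

End Iota.

Arguments vs_embedding {F V} q rho Z.
Arguments conic_nucleus {F V} q rho X.
Arguments nuclei_span {F V} q rho.
Arguments iota1 {F V} q rho X.

(* Main.v *)
From HB Require Import structures.
Require Import Defs.
From mathcomp Require Import all_boot all_order all_algebra.
From mathcomp Require Import boolp classical_sets functions.

Set Implicit Arguments.
Unset Strict Implicit.
Unset Printing Implicit Defensive.

Import GRing.Theory.
Local Open Scope classical_set_scope.
Local Open Scope ring_scope.

(** Let [x] be a singular vector. The line of the dual polar space attached to
    [<x>] is sent by the spin embedding onto all points of a line of
    PG(3, F), that is, of a 2-dimensional space [<s, t>] of spinors: those that
    [x] kills ([spin_embedding_line]). Under the veronesean this line becomes
    the conic [{a^2 ver(s) + a b n + b^2 ver(t)}], where [n] is the image of the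
    bivector [s /\ t]; in characteristic 2 all its tangents pass through [n]
    ([nucleus_conic]). So the nucleus attached to [<x>] is the Pluecker point of
    the line [<s, t>], inside the space of alternating 4 x 4 matrices.

    It remains to see that this Pluecker point is a linear function of [x]. The
    vectors act on spinors as follows. The radical of the polar form is spanned
    by some [r], on which [q] does not vanish ([frame_exists]), and [v |-> v r]
    satisfies the Clifford relations up to the factor [q r]. Let [J] be the
    inverse of the invariant symplectic form on spinors. Then [(x r) J] is an
    alternating matrix for every [x] ([spin_bivector]). For singular [x] its
    columns lie in the image of [x r], which is the kernel [<s, t>], so it is a
    multiple of the bivector [s /\ t] ([alternating_plane]). Hence the nuclei are
    the images of the singular points under the linear map [x |-> (x r) J], which
    is injective by the Clifford relations and the non-singularity of [q]
    ([nucleus_map]).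

    Since the singular vectors span [V] ([singular_span]), the nuclei span the
    image of that map, and its inverse is the required isomorphism from [iota1] to
    the natural embedding; being an embedding is carried over by it. *)

(** * Lines, planes and bivectors *)

Section LinearAlgebra.
Variable F : fieldType.

Lemma linear_lfun (V W : vectType F) (f : V -> W) :
  linear f -> exists g : 'Hom(V, W), forall v, g v = f v.
Proof.
move=> linf.
pose L := GRing.isLinear.Build F V W *:%R f linf.
pose g : {linear V -> W} := HB.pack f L.
by exists (linfun g) => v; rewrite lfunE.
Qed.

Lemma free2P (W : vectType F) (a b : W) :
  reflect (forall x y, x *: a + y *: b = 0 -> x = 0 /\ y = 0)
          (free [:: a; b]).
Proof.
apply: (iffP (@freeP _ _ _ [tuple a; b])) => H.
  move=> x y xy0.
  have K := H (fun i : 'I_2 => if i == ord0 then x else y).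
  rewrite !big_ord_recl big_ord0 /= addr0 in K.
  by have := K xy0 ord0; have := K xy0 (lift ord0 ord0).
move=> k; rewrite !big_ord_recl big_ord0 /= addr0 => /H [k0 k1].
by case=> [[|[|//]] lt_i]; [rewrite -k0 | rewrite -k1]; congr k; apply/val_inj.
Qed.

Lemma free2C (W : vectType F) (a b : W) : free [:: a; b] = free [:: b; a].
Proof. by apply: perm_free; rewrite (perm_catC [:: a] [:: b]). Qed.

Lemma memv_span2 (W : vectType F) (a b v : W) :
  reflect (exists xy : F * F, v = xy.1 *: a + xy.2 *: b) (v \in <<[:: a; b]>>%VS).
Proof.
rewrite span_cons span_seq1; apply: (iffP memv_addP).
  by case=> _ /vlineP[x ->] [_ /vlineP[y ->] ->]; exists (x, y).
case=> -[x y] /= ->; exists (x *: a); first by rewrite memvZ ?memv_line.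
by exists (y *: b); rewrite ?memvZ ?memv_line.
Qed.

Lemma memv_span3 (W : vectType F) (a b c v : W) :
  v \in <<[:: a; b; c]>>%VS ->
  exists x y z, v = x *: a + y *: b + z *: c.
Proof.
rewrite span_cons => /memv_addP[_ /vlineP[x ->]] [w /memv_span2[[y z] /= ->] ->].
by exists x, y, z; rewrite addrA.
Qed.

Lemma dimv1P (W : vectType F) (p : {vspace W}) :
  \dim p = 1%N -> exists2 v, v != 0 & p = <[v]>%VS.
Proof.
move=> dp; have v0 : vpick p != 0 by rewrite vpick0 -dimv_eq0 dp.
exists (vpick p) => //; apply/esym/eqP.
by rewrite eqEdim dim_vline v0 dp -memvE memv_pick.
Qed.

Lemma dimv1_eq (W : vectType F) (p q : {vspace W}) :
  \dim p = 1%N -> \dim q = 1%N -> (p <= q)%VS -> p = q.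
Proof. by move=> dp dq pq; apply/eqP; rewrite eqEdim pq dp dq. Qed.

Lemma vlineZ (W : vectType F) k (v : W) : k != 0 -> <[k *: v]>%VS = <[v]>%VS.
Proof.
move=> k0; apply/eqP; rewrite eqEdim !dim_vline scaler_eq0 (negbTE k0) /=.
by rewrite leqnn andbT -memvE memvZ ?memv_line.
Qed.

Lemma dimv2_basis (W : vectType F) (U : {vspace W}) (v : W) :
  \dim U = 2%N -> v \in U -> v != 0 ->
  exists2 w, free [:: v; w] & U = <<[:: v; w]>>%VS.
Proof.
move=> dU vU v0.
have [w wU wv] : exists2 w, w \in U & w \notin <[v]>%VS.
  by apply/subvPn/negP => /dimvS; rewrite dU dim_vline v0.
have fr : free [:: v; w].
  by rewrite free2C free_cons span_seq1 wv seq1_free v0.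
exists w => //; apply/esym/eqP; rewrite eqEdim dU (eqP fr) /= andbT.
by apply/span_subvP => x; rewrite !inE => /orP[] /eqP ->.
Qed.

Lemma span_ind (W : vectType F) (P : W -> Prop) (X : seq W) :
  P 0 -> (forall k u v, P u -> P v -> P (k *: u + v)) ->
  (forall v, v \in X -> P v) -> forall v, v \in <<X>>%VS -> P v.
Proof.
move=> P0 Plin; elim: X => [|x X IH] PX v.
  by rewrite span_nil memv0 => /eqP ->.
rewrite span_cons => /memv_addP[_ /vlineP[k ->] [w wX ->]].
apply: Plin; first by apply: PX; rewrite mem_head.
by apply: IH => // y yX; apply: PX; rewrite in_cons yX orbT.
Qed.

Lemma memv_bigcap (W : vectType F) (I : eqType) (R : seq I) (U : I -> {vspace W}) v :
  reflect {in R, forall i, v \in U i} (v \in (\bigcap_(i <- R) U i)%VS).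
Proof.
have -> : (v \in (\bigcap_(i <- R) U i)%VS) = all (fun i => v \in U i) R.
  by elim: R => [|i R IH]; rewrite ?big_nil ?memvf // big_cons memv_cap IH.
exact: allP.
Qed.

Lemma mulmx_col m n p (A : 'M[F]_(m, n)) (B : 'M_(n, p)) j :
  A *m col j B = col j (A *m B).
Proof. by rewrite !colE mulmxA. Qed.

Lemma dual_rows n (s t : 'cV[F]_n) : free [:: s; t] ->
  exists u w : 'rV[F]_n,
    [/\ u *m s = 1, u *m t = 0, w *m s = 0 & w *m t = 1].
Proof.
move=> fr.
have row_of (fX : seq F^o) : size fX = 2%N ->
    exists u : 'rV[F]_n, u *m s = (nth 0 fX 0)%:M /\ u *m t = (nth 0 fX 1)%:M.
  move=> sz; have [f /(_ fr sz) fE] := linear_of_free [:: s; t] fX.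
  exists (\row_j f (delta_mx j 0)).
  have uE v : (\row_j f (delta_mx j 0)) *m v = (f v)%:M.
    apply/matrixP => i k; rewrite !ord1 !mxE /= mulr1n.
    rewrite [in RHS](matrix_sum_delta v) linear_sum /=; apply: eq_bigr => j _.
    by rewrite big_ord1 linearZ /= mxE [_ *: _]mulrC.
  by rewrite !uE -fE.
have [u [us ut]] := row_of [:: 1; 0] erefl.
have [w [ws wt]] := row_of [:: 0; 1] erefl.
by exists u, w; rewrite us ut ws wt /= !raddf0.
Qed.

Lemma is_span_uniq (W : vectType F) (A : set {vspace W}) U :
  is_span A U -> span_of A = U.
Proof.
move=> [AU minU]; apply: xget_unique => [//|U' [AU' minU']].
by apply: subv_anti; rewrite minU // minU'.
Qed.

End LinearAlgebra.

Section Char2.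
Variables (F : fieldType) (char2 : 2%N \in [pchar F]).

Lemma addvv2 (W : lmodType F) (v : W) : v + v = 0.
Proof. by rewrite -[v]scale1r -scalerDl addrr_pchar2 // scale0r. Qed.

Lemma oppv2 (W : lmodType F) (v : W) : - v = v.
Proof. by apply/eqP; rewrite -subr_eq0 -opprD addvv2 oppr0. Qed.

Section Bivectors.
Variable n : nat.
Implicit Types (s t v w : 'cV[F]_n) (A : 'M[F]_n).

(** In characteristic 2 this matrix is alternating and represents the bivector
    [s /\ t]; it is also the polarization of [s |-> s *m s^T]. *)
Definition wedge s t : 'M[F]_n := s *m t^T + t *m s^T.
Arguments wedge : simpl never.

Lemma wedgeC s t : wedge s t = wedge t s.
Proof. exact: addrC. Qed.

Lemma wedgeDr s t v : wedge s (t + v) = wedge s t + wedge s v.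
Proof. by rewrite /wedge linearD /= mulmxDr mulmxDl addrACA. Qed.

Lemma wedgeZr k s t : wedge s (k *: t) = k *: wedge s t.
Proof. by rewrite /wedge linearZ /= -scalemxAr -scalemxAl scalerDr. Qed.

Lemma wedgevv s : wedge s s = 0. Proof. exact: addvv2. Qed.

(** The bivector of a plane changes by a determinant, so the point that it
    spans depends on the plane only. *)
Lemma wedge_comb a b c d v w :
  wedge (a *: v + b *: w) (c *: v + d *: w) = (a * d + b * c) *: wedge v w.
Proof.
rewrite wedgeDr !wedgeZr ![wedge (_ + _) _]wedgeC !wedgeDr !wedgeZr !wedgevv.
by rewrite !scaler0 addr0 add0r (wedgeC w) !scalerA -scalerDl addrC (mulrC d) (mulrC c).
Qed.

Lemma tr_wedge s t : (wedge s t)^T = wedge s t.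
Proof. by rewrite /wedge linearD /= !trmx_mul !trmxK addrC. Qed.

Lemma mulmx_wedge A s t : A *m wedge s t = A *m s *m t^T + A *m t *m s^T.
Proof. by rewrite /wedge mulmxDr !mulmxA. Qed.

(** In characteristic 2 this is symmetry with zero diagonal. This form of the
    condition makes stability under congruence and linear combinations
    immediate. *)
Definition alternating (A : 'M[F]_n) := exists T, A = T + T^T.

Lemma alternating_wedge s t : alternating (wedge s t).
Proof. by exists (s *m t^T); rewrite trmx_mul trmxK. Qed.

Lemma alternating_comb k A B : alternating A -> alternating B ->
  alternating (k *: A + B).
Proof.
move=> [T ->] [U ->]; exists (k *: T + U).
by rewrite linearP /= scalerDr addrACA.
Qed.

Lemma alternating_tr A : alternating A -> A^T = A.
Proof. by move=> [T ->]; rewrite linearD /= trmxK addrC. Qed.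

(** A 1 x 1 matrix equals its transpose, so [u T u^T] is counted twice. *)
Lemma alternating_quad A (u : 'rV[F]_n) : alternating A -> u *m A *m u^T = 0.
Proof.
move=> [T ->]; rewrite mulmxDr mulmxDl.
have -> : u *m T^T *m u^T = (u *m T *m u^T)^T by rewrite !trmx_mul trmxK mulmxA.
by rewrite [_ *m u^T]mx11_scalar tr_scalar_mx addvv2.
Qed.

(** With [P] a projection onto the plane [<s, t>], symmetry gives
    [A = P A P^T], so that [A] is determined by the 2 x 2 alternating matrix
    it induces on the plane, and this has a single free entry. *)
Lemma alternating_plane A s t : free [:: s; t] -> alternating A ->
  (forall j, col j A \in <<[:: s; t]>>%VS) ->
  exists k, A = k *: wedge s t.
Proof.
move=> fr altA colA; have [u [w [us ut ws wt]]] := dual_rows fr.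
pose P := s *m u + t *m w.
have PA : P *m A = A.
  apply/matrixP => i j; have /matrixP/(_ i 0) : P *m col j A = col j A.
    have /memv_span2[[x y] /= ->] := colA j.
    rewrite mulmxDr -!scalemxAr !mulmxDl -!mulmxA us ut ws wt !mulmx0 !mulmx1.
    by rewrite addr0 add0r.
  by rewrite mulmx_col !mxE.
have PAP : A = P *m A *m P^T.
  by rewrite PA -{2}(alternating_tr altA) -trmx_mul PA alternating_tr.
have [k kE] : exists k, u *m A *m w^T = k%:M by eexists; apply: mx11_scalar.
exists k.
have uw : w *m A *m u^T = u *m A *m w^T.
  have <- : (u *m A *m w^T)^T = w *m A *m u^T.
    by rewrite !trmx_mul trmxK alternating_tr // mulmxA.
  by rewrite kE tr_scalar_mx.
rewrite {1}PAP /P linearD /= !trmx_mul !mulmxDl !mulmxDr.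
have E (a b : 'cV[F]_n) (x y : 'rV[F]_n) :
    a *m x *m A *m (y^T *m b^T) = a *m (x *m A *m y^T) *m b^T.
  by rewrite !mulmxA.
rewrite !E uw !alternating_quad // !mulmx0 !mul0mx add0r addr0.
by rewrite kE !mul_mx_scalar -!scalemxAl -scalerDr.
Qed.

End Bivectors.

(** * Nuclei of the conics on the quadric veronesean *)

Section Conic.

(** The upper triangle identifies the symmetric 4 x 4 matrices with the
    ambient space of the veronesean, and [s *m s^T] with [veronese s]. *)
Definition upper (A : 'M[F]_4) : ver_space F :=
  [ffun ij : ver_index => A (val ij).1 (val ij).2].

Lemma upper_linear : linear upper.
Proof. by move=> k A B; apply/ffunP => ij; rewrite !ffunE !mxE. Qed.

HB.instance Definition _ := @GRing.isLinear.Build F 'M[F]_4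
  (ver_space F) *:%R upper upper_linear.

Lemma upper_inj_sym A : A^T = A -> upper A = 0 -> A = 0.
Proof.
move=> symA A0.
have le0 (i j : 'I_4) : (i <= j)%N -> A i j = 0.
  move=> ij; have := congr1 (fun f : ver_space F => f (Sub (i, j) ij)) A0.
  by rewrite !ffunE.
apply/matrixP => i j; rewrite mxE.
case/orP: (leq_total i j) => [/le0 //|/le0 ji].
by rewrite -symA mxE.
Qed.

Lemma veroneseE s : veronese s = upper (s *m s^T).
Proof. by apply/ffunP => ij; rewrite !ffunE !mxE big_ord1 !mxE. Qed.

Lemma veroneseZ (k : F) (s : 'cV_4) : veronese (k *: s) = k ^+ 2 *: veronese s.
Proof. by rewrite !veroneseE linearZ /= -scalemxAl -scalemxAr scalerA linearZ. Qed.

(** On the line [<s, t>] the veronesean is the conic [{x^2 a + x y n + y^2 b}],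
    whose middle coefficient [n] comes from the bivector [s /\ t]. *)
Lemma veronese_comb (x y : F) (s t : 'cV_4) :
  veronese (x *: s + y *: t) =
  x ^+ 2 *: veronese s + (x * y) *: upper (wedge s t) + y ^+ 2 *: veronese t.
Proof.
rewrite !veroneseE -[RHS]/(_ + _ + _); set X := _ *m _.
have -> : X = x ^+ 2 *: (s *m s^T) + (x * y) *: wedge s t + y ^+ 2 *: (t *m t^T).
  rewrite /X linearD /= !linearZ /= mulmxDr !mulmxDl -!scalemxAl -!scalemxAr !scalerA.
  by rewrite /wedge scalerDr (mulrC y x) !expr2 -!addrA; congr (_ + _); rewrite addrCA.
by rewrite !linearD !linearZ.
Qed.

Lemma conic_frame_indep (s t : 'cV[F]_4) x y z : free [:: s; t] ->
  x *: veronese s + y *: upper (wedge s t) + z *: veronese t = 0 ->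
  [/\ x = 0, y = 0 & z = 0].
Proof.
move=> st_free; set A := x *: (s *m s^T) + y *: wedge s t + z *: (t *m t^T).
have -> : x *: veronese s + y *: upper (wedge s t) + z *: veronese t = upper A.
  by rewrite !veroneseE !linearD !linearZ.
move=> /upper_inj_sym A0; have {}A0 : A = 0.
  by apply: A0; rewrite /A 2!linearD /= !linearZ /= tr_wedge !trmx_mul !trmxK.
have [u [w [us ut ws wt]]] := dual_rows st_free.
have ev (a b : 'rV[F]_4) :
    x *: (a *m s *m (b *m s)^T) +
    y *: (a *m s *m (b *m t)^T + a *m t *m (b *m s)^T) +
    z *: (a *m t *m (b *m t)^T) = 0.
  have := congr1 (fun A => a *m A *m b^T) A0.
  rewrite /wedge mulmx0 mul0mx !(mulmxDr, mulmxDl, =^~ scalemxAr, =^~ scalemxAl).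
  by rewrite !trmx_mul !mulmxA.
have sc (k : F) : k *: (1 : 'M[F]_1) = 0 -> k = 0.
  by move=> /eqP; rewrite scaler_eq0 oner_eq0 orbF => /eqP.
have o1 : (1 : 'M[F]_1) *m 1^T = 1 by rewrite trmx1 mulmx1.
split; apply: sc.
- by have := ev u u; rewrite us ut trmx0 mulmx0 !mul0mx o1 !addr0 !scaler0 !addr0.
- by have := ev u w; rewrite us ut ws wt !trmx0 !mulmx0 !mul0mx o1 !addr0 !scaler0 add0r addr0.
- by have := ev w w; rewrite ws wt trmx0 !mulmx0 !mul0mx o1 !addr0 !scaler0 !add0r.
Qed.

Definition conic (S : {vspace 'cV[F]_4}) : set {vspace ver_space F} :=
  @veronese_point F @` proj_points S.

Lemma veronese_eq0 (s : 'cV[F]_4) : (veronese s == 0) = (s == 0).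
Proof.
apply/eqP/eqP => [s0|->]; last first.
  by rewrite -(scale0r 0) veroneseZ expr0n /= scale0r.
apply/matrixP => i j; rewrite !ord1 mxE; apply/eqP.
have := congr1 (fun f : ver_space F => f (Sub (i, i) (leqnn i))) s0.
by rewrite !ffunE /= => /eqP; rewrite mulf_eq0 orbb.
Qed.

Lemma veronese_point_line (s : 'cV[F]_4) : s != 0 ->
  veronese_point <[s]> = <[veronese s]>%VS.
Proof.
move=> s0; rewrite /veronese_point.
have p0 : vpick <[s]> != 0 by rewrite vpick0 -dimv_eq0 dim_vline s0.
have /vlineP[k kE] : vpick <[s]> \in <[s]>%VS by apply: memv_pick.
rewrite kE veroneseZ vlineZ // expf_neq0 //.
by apply: contraNneq p0 => k0; rewrite kE k0 scale0r.
Qed.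

Lemma conicP S p :
  conic S p <-> exists s, [/\ s \in S, s != 0 & p = <[veronese s]>%VS].
Proof.
split=> [[l [/dimv1P[s s0 ->] sS] <-]|[s [sS s0 ->]]].
  by exists s; rewrite veronese_point_line.
by exists <[s]>%VS; [split; rewrite ?dim_vline ?s0|rewrite veronese_point_line].
Qed.

Lemma span_conic (s t : 'cV[F]_4) :
  span_of (conic <<[:: s; t]>>) =
  <<[:: veronese s; upper (wedge s t); veronese t]>>%VS.
Proof.
apply: is_span_uniq; split=> [p /conicP[v [/memv_span2[[x y] /= ->] _ ->]]|U HU].
  rewrite -memvE veronese_comb.
  by rewrite !memvD ?memvZ ?memv_span // !inE eqxx ?orbT.
have inU (v : 'cV[F]_4) : v \in <<[:: s; t]>>%VS -> veronese v \in U.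
  move=> vS; have [->|v0] := eqVneq v 0.
    have /eqP -> : veronese (0 : 'cV[F]_4) == 0 by rewrite veronese_eq0.
    exact: mem0v.
  by rewrite memvE; apply: HU; apply/conicP; exists v.
have sS : s \in <<[:: s; t]>>%VS by rewrite memv_span ?inE ?eqxx.
have tS : t \in <<[:: s; t]>>%VS by rewrite memv_span ?inE ?eqxx ?orbT.
apply/span_subvP => v; rewrite !inE => /or3P[] /eqP -> //; try exact: inU.
have -> : upper (wedge s t) = veronese (s + t) - veronese s - veronese t.
  rewrite -[in RHS](scale1r s) -[in RHS](scale1r t).
  by rewrite veronese_comb !veroneseZ expr1n mulr1 !scale1r addrAC addrK addrAC subrr add0r.
by rewrite !memvB ?inU // memvD.
Qed.

(** If a line [L] of the plane of the conic through the point of [s] contained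
    a vector outside [<veronese s, s /\ t>], it would be a secant. *)
Lemma tangent_contains_nucleus s t L : free [:: s; t] ->
  tangent_line (conic <<[:: s; t]>>) L ->
  conic <<[:: s; t]>> `&` proj_points L = [set <[veronese s]>%VS] ->
  upper (wedge s t) \in L.
Proof.
move=> fr [dL Lsub _] meet.
have vs0 : veronese s != 0.
  by rewrite veronese_eq0 (free_not0 fr) // inE eqxx.
have sL : veronese s \in L.
  have : [set <[veronese s]>%VS] <[veronese s]>%VS by [].
  by rewrite -meet memvE => -[_ []].
have [m frm LE] := dimv2_basis dL sL vs0.
have mL : m \in L by rewrite LE memv_span // !inE eqxx orbT.
have := subvP Lsub m mL; rewrite span_conic => /memv_span3[x [y [z mE]]].
have ynzL : y *: upper (wedge s t) + z *: veronese t \in L.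
  rewrite (_ : _ + _ = m - x *: veronese s) ?memvB ?memvZ // mE.
  by rewrite -(addrA (x *: _)) (addrC (x *: _)) addrK.
have z0 : z = 0.
  apply/eqP/negPn/negP => z0.
  (* [veronese (y s + z t)] is [y^2 veronese s] plus [z] times the point
     [y wedge s t + z veronese t] of [L], so it is a second point of the conic
     on [L]. *)
  pose v := y *: s + z *: t.
  have v0 : v != 0.
    apply: contraNneq z0 => v0.
    by have /free2P/(_ _ _ v0)[_ ->] := fr.
  have vL : veronese v \in L.
    rewrite veronese_comb -addrA memvD ?memvZ //.
    by rewrite expr2 (mulrC y) -!scalerA -scalerDr memvZ.
  have : (conic <<[:: s; t]>> `&` proj_points L) <[veronese v]>%VS.
    split; first by apply/conicP; exists v; split=> //; apply/memv_span2; exists (y, z).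
    by split; rewrite ?dim_vline ?veronese_eq0 ?v0 // -memvE.
  rewrite meet /= => vs.
  have /vlineP[k] : veronese v \in <[veronese s]>%VS by rewrite -vs memv_line.
  rewrite /v veronese_comb => vE.
  have [] := @conic_frame_indep s t (y ^+ 2 - k) (y * z) (z ^+ 2) fr.
    by rewrite scalerBl -vE -!addrA [- _ + _]addrC !addrA subrr.
  by move=> _ _ /eqP; rewrite expf_eq0 /= (negbTE z0).
have y0 : y != 0.
  apply/negP => /eqP y0; move/free2P: frm => /(_ x (-1)).
  rewrite mE y0 z0 !scale0r !addr0 scaleN1r subrr => /(_ erefl) [_ /eqP].
  by rewrite oppr_eq0 oner_eq0.
move: ynzL; rewrite z0 scale0r addr0 => yL.
by rewrite -(scalerK y0 (upper _)) memvZ.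
Qed.

(** The conic is [{x^2 a + x y n + y^2 b}]. Its tangent at [(x, y)] joins this
    point to the value of the polarization, which in characteristic 2 is always
    a multiple of [n]: this is the classical reason why all tangents concur. *)
Lemma nucleus_conic s t : free [:: s; t] ->
  nucleus (conic <<[:: s; t]>>) = <[upper (wedge s t)]>%VS.
Proof.
move=> fr.
have fr' : free [:: t; s] by rewrite free2C.
have spanC : (<<[:: t; s]>> = <<[:: s; t]>>)%VS.
  by apply: eq_span => v; rewrite !inE orbC.
have n0 (a b : 'cV[F]_4) : free [:: a; b] -> upper (wedge a b) != 0.
  move=> fab; apply/eqP => n0.
  have [] := @conic_frame_indep a b 0 1 0 fab.
    by rewrite n0 !scale0r scaler0 !addr0.
  by move=> _ /eqP; rewrite oner_eq0.
have tangent (a b : 'cV[F]_4) : free [:: a; b] ->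
    tangent_line (conic <<[:: a; b]>>) <<[:: veronese a; upper (wedge a b)]>>.
  move=> fab.
  have fan : free [:: veronese a; upper (wedge a b)].
    apply/free2P => x y xy0.
    have [] := @conic_frame_indep a b x y 0 fab; last by [].
    by rewrite scale0r addr0.
  have a0 : a != 0 by rewrite (free_not0 fab) // inE eqxx.
  split; first by apply/eqP.
    rewrite span_conic; apply: sub_span => v.
    by rewrite !inE => /orP[] ->; rewrite ?orbT.
  exists <[veronese a]>%VS; apply/seteqP; split=> [p|_ ->]; last first.
    split; first by apply/conicP; exists a; split=> //; rewrite memv_span ?inE ?eqxx.
    split; first by rewrite dim_vline veronese_eq0 a0.
    by rewrite -memvE memv_span ?inE ?eqxx.
  case=> /conicP[v [/memv_span2[[x y] /= ->] v0 ->]] [_].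
  rewrite -memvE => /memv_span2[[x' y'] /=]; rewrite veronese_comb => vE.
  have [] := @conic_frame_indep a b (x ^+ 2 - x') (x * y - y') (y ^+ 2) fab.
    rewrite !scalerBl [_ *: _ - _ + _]addrACA -opprD -vE.
    by rewrite -!addrA [- _ + _]addrC !addrA subrr.
  move=> _ _ /eqP; rewrite expf_eq0 /= => /eqP y0; move: v0.
  rewrite y0 scale0r addr0 scaler_eq0 negb_or => /andP[x0 _].
  by rewrite expr0n /= scale0r mulr0 scale0r !addr0 vlineZ ?expf_neq0.
have nucP p : (\dim p = 1%N /\
    forall L, tangent_line (conic <<[:: s; t]>>) L -> (p <= L)%VS) <->
    p = <[upper (wedge s t)]>%VS.
  split=> [[dp pL]|->].
    (* The tangents at [s] and at [t] already meet in the nucleus alone. *)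
    have [m m0 pE] := dimv1P dp.
    have /memv_span2[[x y] /= mE] : m \in <<[:: veronese s; upper (wedge s t)]>>%VS.
      by rewrite memvE -pE; apply/pL/tangent.
    have /memv_span2[[x' y'] /= mE'] :
        m \in <<[:: veronese t; upper (wedge t s)]>>%VS.
      by rewrite memvE -pE; apply: pL; rewrite -spanC; apply: tangent.
    have [] := @conic_frame_indep s t x (y - y') (- x') fr.
      apply/eqP; rewrite scalerBl scaleNr addrA -mE (wedgeC s t) -addrA -opprD.
      by rewrite (addrC (y' *: _)) -mE' subrr.
    move=> x0 _ _; rewrite pE mE x0 scale0r add0r vlineZ //.
    by apply: contraNneq m0 => y0; rewrite mE x0 y0 !scale0r addr0.
  split=> [|L]; first by rewrite dim_vline n0.
  move=> tL; have [_ _ [r meet]] := tL; rewrite -memvE.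
  have [/conicP[v [vS v0 rE]] _] : (conic <<[:: s; t]>> `&` proj_points L) r.
    by rewrite meet.
  (* [L] is tangent at the image of [v], so a basis of the plane that starts
     with [v] is needed. *)
  have dS : \dim <<[:: s; t]>> = 2%N by apply/eqP.
  have [w fvw SE] := dimv2_basis dS vS v0.
  have vwL : upper (wedge v w) \in L.
    by apply: tangent_contains_nucleus; rewrite -?SE // meet rE.
  have [/memv_span2[[a b] /= sE] /memv_span2[[c d] /= tE]] :
      s \in <<[:: v; w]>>%VS /\ t \in <<[:: v; w]>>%VS.
    by rewrite -SE !memv_span // !inE eqxx ?orbT.
  by rewrite sE tE wedge_comb linearZ memvZ.
apply: xget_unique => [|n nucn].
  by rewrite /is_nucleus; apply/seteqP; split=> x /= /nucP.
by apply/nucP; have : [set n] n by []; rewrite -nucn.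
Qed.

End Conic.

End Char2.

(** * Quadratic spaces of dimension 5 and Witt index 2 *)

Section QuadraticSpace.
Variables (F : fieldType) (char2 : 2%N \in [pchar F]) (V : vectType F).
Variables (q : V -> F) (q_quad : quadratic_form q).

Lemma polarDr u v w : polar q u (v + w) = polar q u v + polar q u w.
Proof. by have := q_quad.2 u 1 v w; rewrite scale1r mul1r. Qed.

Lemma polarC u v : polar q u v = polar q v u.
Proof. by rewrite /polar (addrC u v) -!addrA (addrC (- q u)). Qed.

Lemma polarDl u v w : polar q (u + v) w = polar q u w + polar q v w.
Proof. by rewrite !(polarC _ w) polarDr. Qed.

Lemma polar0r u : polar q u 0 = 0.
Proof. by apply: (addrI (polar q u 0)); rewrite -polarDr !addr0. Qed.

Lemma polarZr u k v : polar q u (k *: v) = k * polar q u v.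
Proof. by have := q_quad.2 u k v 0; rewrite polar0r !addr0. Qed.

Lemma polarZl u k v : polar q (k *: u) v = k * polar q u v.
Proof. by rewrite !(polarC _ v) polarZr. Qed.

Lemma quadD u v : q (u + v) = q u + q v + polar q u v.
Proof. by rewrite /polar [RHS]addrC -(addrA (q (u + v))) -opprD subrK. Qed.

Lemma quadZ k v : q (k *: v) = k ^+ 2 * q v.
Proof. exact: q_quad.1. Qed.

Lemma polarvv v : polar q v v = 0.
Proof.
rewrite /polar -{1}[v]scale1r -{2}[v]scale1r -scalerDl quadZ.
by rewrite addrr_pchar2 // expr0n mul0r sub0r -opprD addrr_pchar2 // oppr0.
Qed.

Lemma singular_nonradical (q_ns : nonsingular q) v : v != 0 -> q v = 0 ->
  exists w, polar q v w = 1.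
Proof.
move=> v0 qv; have [w vw] : exists w, polar q v w != 0.
  apply: contrapT => H; suff : q v != 0 by rewrite qv eqxx.
  apply: q_ns => // w.
  by apply/eqP/negPn/negP => vw; apply: H; exists w.
by exists ((polar q v w)^-1 *: w); rewrite polarZr mulVf.
Qed.

(** On a line through a singular point, not tangent to the quadric there,
    a second singular point can be chosen. *)
Lemma singular_shift v w : q v = 0 -> polar q v w = 1 ->
  q (w - q w *: v) = 0 /\ polar q v (w - q w *: v) = 1.
Proof.
move=> qv vw; rewrite -scaleNr polarDr polarZr polarvv mulr0 addr0; split=> //.
by rewrite quadD quadZ qv mulr0 addr0 polarZr polarC vw mulr1 subrr.
Qed.

Lemma totally_singular_line v : q v = 0 -> totally_singular q <[v]>%VS.
Proof. by move=> qv _ /vlineP[k ->]; rewrite quadZ qv mulr0. Qed.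

Lemma ts_pointP X : ts_space q 1 X <-> exists v, [/\ v != 0, q v = 0 & X = <[v]>%VS].
Proof.
split=> [[/dimv1P[v v0 XE] tsX]|[v [v0 qv ->]]].
  by exists v; split=> //; apply: tsX; rewrite XE memv_line.
by split; [rewrite dim_vline v0|apply: totally_singular_line].
Qed.

Lemma singular_polar0 (U : {vspace V}) u v : totally_singular q U -> u \in U -> v \in U ->
  polar q u v = 0.
Proof. by move=> tsU uU vU; rewrite /polar !tsU ?memvD // !subr0. Qed.

Section Frame.
Hypotheses (dimV : \dim (fullv : {vspace V}) = 5%N) (q_ns : nonsingular q).
Hypothesis q_witt : witt_index q 2.

Lemma singular_point_exists : exists2 v : V, v != 0 & q v = 0.
Proof.
have [[U tsU dU] _] := q_witt.
exists (vpick U); first by rewrite vpick0 -dimv_eq0 dU.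
by apply: tsU; apply: memv_pick.
Qed.

(** Off the hyperplane [x^perp] of a singular [x], [singular_shift] writes every
    vector as a sum of singular ones; and the complement of a hyperplane spans. *)
Lemma singular_span (U : {vspace V}) : (forall v, q v = 0 -> v \in U) -> U = fullv.
Proof.
move=> sU; have [x x0 qx] := singular_point_exists.
have [y xy] := singular_nonradical q_ns x0 qx.
have nperp w : polar q x w != 0 -> w \in U.
  move=> xw; pose w' := (polar q x w)^-1 *: w.
  suff : polar q x w *: w' \in U by rewrite scalerA mulfV // scale1r.
  rewrite memvZ //.
  have xw' : polar q x w' = 1 by rewrite polarZr mulVf.
  have [qs _] := singular_shift qx xw'.
  by rewrite -(subrK (q w' *: x) w') memvD ?memvZ ?sU.
apply/eqP; rewrite eqEsubv subvf; apply/subvP => z _.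
have [xz|/nperp //] := eqVneq (polar q x z) 0.
by rewrite -(addrK y z) memvB // nperp // ?polarDr ?xz ?xy ?add0r oner_eq0.
Qed.

(** Two hyperbolic pairs and a vector [r] of the radical of the polar form. The
    radical is nonzero because alternating forms in odd dimension degenerate. *)
Record frame (e1 e2 f1 f2 r : V) : Prop := Frame {
  frame_span : (<<[:: e1; e2; f1; f2; r]>> = fullv)%VS;
  frame_e1 : q e1 = 0; frame_e2 : q e2 = 0;
  frame_f1 : q f1 = 0; frame_f2 : q f2 = 0;
  frame_e1e2 : polar q e1 e2 = 0; frame_f1f2 : polar q f1 f2 = 0;
  frame_e1f1 : polar q e1 f1 = 1; frame_e2f2 : polar q e2 f2 = 1;
  frame_e1f2 : polar q e1 f2 = 0; frame_e2f1 : polar q e2 f1 = 0;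
  frame_e1_neq0 : e1 != 0;
  frame_r : q r != 0; frame_rad : forall v, polar q r v = 0 }.

(** Nonzero combinations of [e] and [e'] are singular, so not radical. The
    proof takes [z] with [polar e' z = 1], the combination [v = e - k e']
    orthogonal to [z], and [w] with [polar v w = 1]; subtracting a multiple of
    [z] from [w] makes it orthogonal to [e'] and keeps its product with [v],
    which then is its product with [e]. *)
Lemma hyperbolic_partner e e' : free [:: e; e'] -> q e = 0 -> q e' = 0 ->
  polar q e e' = 0 ->
  exists f, [/\ q f = 0, polar q e f = 1 & polar q e' f = 0].
Proof.
move=> fr qe qe' ee'.
have e'0 : e' != 0 by rewrite (free_not0 fr) // !inE eqxx orbT.
have [z e'z] := singular_nonradical q_ns e'0 qe'.
pose v := e - polar q e z *: e'.
have v0 : v != 0.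
  apply/eqP; rewrite /v -[e]scale1r -scaleNr scale1r => /eqP.
  rewrite -{1}[e]scale1r => /eqP v0.
  by have /free2P/(_ _ _ v0)[/eqP] := fr; rewrite oner_eq0.
have qv : q v = 0.
  by rewrite /v -scaleNr quadD quadZ polarZr qe qe' ee' !mulr0 !addr0.
have [w vw] := singular_nonradical q_ns v0 qv.
pose f := w - polar q e' w *: z.
have e'f : polar q e' f = 0.
  by rewrite /f -scaleNr polarDr polarZr e'z mulr1 subrr.
have ef : polar q e f = 1.
  rewrite -vw /v /f -!scaleNr polarDr polarZr polarDl polarZl.
  by rewrite !mulNr mulrC.
have [qf' ef'] := singular_shift qe ef.
exists (f - q f *: e); split=> //.
by rewrite -scaleNr polarDr polarZr e'f polarC ee' mulr0 addr0.
Qed.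

(** A totally singular plane [<e1, e2>] is completed to a hyperbolic 4-space,
    whose orthogonal complement is a line [<r>]. As [r] is orthogonal to the
    4-space and, in characteristic 2, to itself, it is radical. *)
Lemma frame_exists : exists e1 e2 f1 f2 r, frame e1 e2 f1 f2 r.
Proof.
have [[U tsU dU] _] := q_witt.
have e10 : vpick U != 0 by rewrite vpick0 -dimv_eq0 dU.
have [e2 fr UE] := dimv2_basis dU (memv_pick U) e10.
move: (vpick U) e10 fr UE => e1 e10 fr UE.
have e1U : e1 \in U by rewrite UE memv_span // !inE eqxx.
have e2U : e2 \in U by rewrite UE memv_span // !inE eqxx orbT.
have qe1 := tsU _ e1U; have qe2 := tsU _ e2U.
have e12 := singular_polar0 tsU e1U e2U.
have fr' : free [:: e2; e1] by rewrite free2C.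
have e21 : polar q e2 e1 = 0 by rewrite polarC.
have [f1 [qf1 e1f1 e2f1]] := hyperbolic_partner fr qe1 qe2 e12.
have [f [_ e2f e1f]] := hyperbolic_partner fr' qe2 qe1 e21.
pose g := f - polar q f1 f *: e1.
have e2g : polar q e2 g = 1.
  by rewrite /g -scaleNr polarDr polarZr e2f e21 mulr0 addr0.
have e1g : polar q e1 g = 0.
  by rewrite /g -scaleNr polarDr polarZr e1f polarvv mulr0 addr0.
have f1g : polar q f1 g = 0.
  by rewrite /g -scaleNr polarDr polarZr (polarC f1 e1) e1f1 mulr1 subrr.
have [qf2 e2f2] := singular_shift qe2 e2g.
have [f2 f2E] : exists f2, f2 = g - q g *: e2 by exists (g - q g *: e2).
rewrite -f2E in qf2 e2f2.
have e1f2 : polar q e1 f2 = 0.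
  by rewrite f2E -scaleNr polarDr polarZr e1g e12 mulr0 addr0.
have f1f2 : polar q f1 f2 = 0.
  by rewrite f2E -scaleNr polarDr polarZr f1g (polarC f1 e2) e2f1 mulr0 addr0.
(* The common kernel of the four pairings is the complement of the 4-space. *)
have [T TE] : exists T : 'Hom(V, 'rV[F]_4), forall v, T v =
    \row_j [:: polar q e1 v; polar q e2 v; polar q f1 v; polar q f2 v]`_j.
  apply: linear_lfun => k u v; apply/rowP => j; rewrite !mxE.
  by case: j => [[|[|[|[|//]]]]] /= _; rewrite polarDr polarZr.
have surj (a b c d : F) : exists v, [/\ v \in <<[:: e1; e2; f1; f2]>>%VS,
    polar q e1 v = a, polar q e2 v = b, polar q f1 v = c & polar q f2 v = d].
  exists (c *: e1 + d *: e2 + a *: f1 + b *: f2); split.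
  - by rewrite !memvD ?memvZ ?memv_span // !inE eqxx ?orbT.
  - by rewrite !polarDr !polarZr polarvv e12 e1f1 e1f2 !mulr0 !add0r mulr1 addr0.
  - by rewrite !polarDr !polarZr polarvv e21 e2f1 e2f2 !mulr0 !add0r mulr1.
  - by rewrite !polarDr !polarZr polarvv f1f2 !(polarC f1) e1f1 e2f1 !mulr0 !addr0 mulr1.
  - by rewrite !polarDr !polarZr polarvv !(polarC f2) f1f2 e1f2 e2f2 !mulr0 !add0r !addr0 mulr1.
have dker : \dim (lker T) = 1%N.
  have := limg_ker_dim T fullv; rewrite capfv dimV.
  suff -> : limg T = fullv.
    by rewrite dimvf dim_matrix => /eqP; rewrite (eqn_add2r 4 _ 1) => /eqP.
  apply/eqP; rewrite eqEsubv subvf; apply/subvP => u _.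
  have [v [_ v1 v2 v3 v4]] := surj (u 0 0) (u 0 1) (u 0 2) (u 0 3).
  have -> : u = T v; last by rewrite memv_img ?memvf.
  rewrite TE v1 v2 v3 v4; apply/rowP => -[[|[|[|[|//]]]] lj]; rewrite !mxE /=;
  by congr (u _ _); apply/val_inj.
have [r r0 kerE] := dimv1P dker.
have Tr : T r = 0 by apply/eqP; rewrite -memv_ker kerE memv_line.
have rperp j : [:: polar q e1 r; polar q e2 r; polar q f1 r; polar q f2 r]`_(j : 'I_4) = 0.
  by have /rowP/(_ j) := Tr; rewrite TE !mxE.
have [re1 re2 rf1 rf2] : [/\ polar q r e1 = 0, polar q r e2 = 0, polar q r f1 = 0
    & polar q r f2 = 0].
  by rewrite !(polarC r); split; [exact: (rperp 0)|exact: (rperp 1)|exact: (rperp 2)|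
    exact: (rperp 3)].
have gen (W : {vspace V}) :
    e1 \in W -> e2 \in W -> f1 \in W -> f2 \in W -> r \in W -> W = fullv.
  move=> e1W e2W f1W f2W rW; apply/eqP; rewrite eqEsubv subvf; apply/subvP => v _.
  have [w [wE w1 w2 w3 w4]] :=
    surj (polar q e1 v) (polar q e2 v) (polar q f1 v) (polar q f2 v).
  have wW : w \in W.
    have /span_subvP sub : {subset [:: e1; e2; f1; f2] <= W}.
      by move=> x; rewrite !inE => /or4P[] /eqP ->.
    exact: (subvP sub).
  have : v - w \in lker T.
    by rewrite memv_ker linearB /= !TE w1 w2 w3 w4 subrr.
  rewrite kerE => /vlineP[k vw].
  by rewrite -(subrK w v) vw memvD // memvZ.
have rad v : polar q r v = 0.
  have [L LE] : exists L : 'Hom(V, F^o), forall v, L v = polar q r v.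
    by apply: linear_lfun => k u w; rewrite polarDr polarZr.
  suff : v \in lker L by rewrite memv_ker LE => /eqP.
  rewrite (gen (lker L)) ?memvf // memv_ker LE ?polarvv //;
  by rewrite ?re1 ?re2 ?rf1 ?rf2.
exists e1, e2, f1, f2, r; split=> //; last exact: q_ns.
by apply: gen; rewrite memv_span // !inE eqxx ?orbT.
Qed.

End Frame.
End QuadraticSpace.

(** * Vectors acting on the spin module *)

Section SpinModule.
Variables (F : fieldType) (char2 : 2%N \in [pchar F]) (V : vectType F).
Variables (q : V -> F) (q_quad : quadratic_form q).
Hypotheses (dimV : \dim (fullv : {vspace V}) = 5%N) (q_ns : nonsingular q).
Hypothesis q_witt : witt_index q 2.
Variables (rho : {bilinear V -> V -> 'M[F]_4}) (rho_spin : spin_module q rho).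
Variable r : V.
Hypotheses (r_rad : forall v, polar q r v = 0) (qr_neq0 : q r != 0).

(** A single vector [v] does not act on spinors, but [v r] does, being even. As
    the radical vector [r] commutes with all vectors in characteristic 2, these
    operators satisfy the Clifford relations of the form [q r * q]. *)
Definition hat (v : V) : 'M[F]_4 := rho v r.

Lemma hat_linear : linear hat.
Proof. by move=> k u v; rewrite /hat linearPl. Qed.

HB.instance Definition _ := GRing.isLinear.Build F V 'M[F]_4 *:%R hat hat_linear.

Lemma rho_rad v : rho r v = hat v.
Proof.
have := rho_spin.1 (r + v); rewrite linearDl !linearDr !rho_spin.1.
rewrite (quadD q) r_rad addr0 raddfD /= -addrA => /addrI; rewrite addrA.
rewrite -[X in _ = X]add0r => /addIr /eqP; rewrite addr_eq0 => /eqP ->.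
exact: oppv2.
Qed.

Lemma hatM v w : hat v *m hat w = q r *: rho v w.
Proof. by rewrite -(rho_rad w) rho_spin.2. Qed.

Lemma hat_sq v : hat v *m hat v = (q r * q v)%:M.
Proof. by rewrite hatM rho_spin.1 -scale_scalar_mx. Qed.

Lemma hat_anticomm v w :
  hat v *m hat w + hat w *m hat v = (q r * polar q v w)%:M.
Proof.
rewrite /polar !mulrBr !raddfB /= -!hat_sq linearD /= mulmxDr !mulmxDl.
rewrite [RHS]addrAC addrA addrK -(addrA (hat v *m hat v)).
by rewrite [in RHS](addrC (hat v *m hat v)) addrK addrC.
Qed.

Lemma hat_swap a b (s : 'cV[F]_4) :
  hat a *m (hat b *m s) = (q r * polar q a b) *: s + hat b *m (hat a *m s).
Proof.
rewrite !mulmxA -mul_scalar_mx -mulmxDl -hat_anticomm -addrA addvv2 //.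
by rewrite addr0.
Qed.

Lemma hat_rad : hat r = (q r)%:M.
Proof. exact: rho_spin.1. Qed.

Definition hat_ker (v : V) : {vspace 'cV[F]_4} :=
  lker (linfun (mulmx (hat v) : 'cV[F]_4 -> 'cV[F]_4)).

Lemma hat_kerP v s : reflect (hat v *m s = 0) (s \in hat_ker v).
Proof. by rewrite memv_ker lfunE; apply: eqP. Qed.

Lemma spin_embeddingP Z s :
  s \in spin_embedding q rho Z <-> {in Z, forall v, hat v *m s = 0}.
Proof.
split=> [sZ v vZ|sZ].
  have sE u w : u \in vbasis fullv -> w \in vbasis Z -> rho u w *m s = 0.
    move=> uV wZ; have /memv_bigcap/(_ u uV)/memv_bigcap/(_ w wZ) := sZ.
    by rewrite memv_ker lfunE => /eqP.
  rewrite -rho_rad (coord_vbasis vZ) linear_sumr mulmx_suml big1 // => j _.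
  rewrite linearZr_LR -scalemxAl (coord_vbasis (memvf r)) linear_sumlz.
  rewrite mulmx_suml big1 ?scaler0 // => i _.
  by rewrite linearZl_LR -scalemxAl sE ?scaler0 // mem_nth ?size_tuple.
apply/memv_bigcap => v _; apply/memv_bigcap => u uZ.
rewrite memv_ker lfunE /= -(scalerK qr_neq0 (rho v u)) -hatM -scalemxAl -mulmxA.
by rewrite sZ ?mulmx0 ?scaler0 // vbasis_mem.
Qed.

(** A vector [y] with [polar x y = 1] gives [x y + y x = 1] up to a scalar, so
    the square-zero operator [x] is exact: its kernel is its image. *)
Lemma dim_hat_ker x : x != 0 -> q x = 0 -> \dim (hat_ker x) = 2%N.
Proof.
move=> x0 qx; have [y xy] := singular_nonradical q_quad q_ns x0 qx.
pose f : 'End('cV[F]_4) := linfun (mulmx (hat x) : 'cV[F]_4 -> 'cV[F]_4).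
have := limg_ker_dim f fullv; rewrite capfv dimvf dim_matrix.
suff -> : limg f = hat_ker x by rewrite addnn => /(congr1 half); rewrite doubleK.
apply/vspaceP => s; apply/idP/hat_kerP => [/memv_imgP[t _ ->]|xs].
  by rewrite lfunE /= mulmxA hat_sq qx mulr0 raddf0 mul0mx.
have -> : s = f ((q r)^-1 *: (hat y *m s)).
  by rewrite lfunE /= -scalemxAr hat_swap xs xy mulr1 mulmx0 addr0 scalerK.
by rewrite memv_img ?memvf.
Qed.

(** Choose [f] orthogonal to [z] but not to [x]: it commutes with [z], hence
    preserves its kernel, but sends no nonzero spinor of the kernel of [x] into
    that kernel. *)
Lemma hat_ker_not_sub x z : free [:: x; z] -> q x = 0 -> q z = 0 -> polar q x z = 0 ->
  ~~ (hat_ker x <= hat_ker z)%VS.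
Proof.
move=> fr qx qz xz; apply/negP => /subvP sub.
have x0 : x != 0 by rewrite (free_not0 fr) // !inE eqxx.
have [f [_ xf zf]] := hyperbolic_partner char2 q_quad q_ns fr qx qz xz.
pose s := vpick (hat_ker x).
have s0 : s != 0 by rewrite vpick0 -dimv_eq0 dim_hat_ker.
have xs : hat x *m s = 0 by apply/hat_kerP/memv_pick.
have xfs : hat x *m (hat f *m s) = q r *: s.
  by rewrite hat_swap xs xf mulr1 mulmx0 addr0.
have zs : hat z *m s = 0 by apply/hat_kerP/sub/memv_pick.
have zfs : hat z *m (hat f *m s) = 0.
  by rewrite hat_swap zs zf mulr0 scale0r mulmx0 addr0.
have z0 : z != 0 by rewrite (free_not0 fr) // !inE eqxx orbT.
have kerE : hat_ker x = hat_ker z.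
  by apply/eqP; rewrite eqEdim !dim_hat_ker // leqnn andbT; apply/subvP.
have /hat_kerP/eqP : hat f *m s \in hat_ker x by rewrite kerE; apply/hat_kerP.
by rewrite xfs scaler_eq0 (negbTE qr_neq0) (negbTE s0).
Qed.

(** Orthogonal vectors commute, so [z] acts on the kernel of [x], and it is
    nilpotent there. *)
Lemma hat_ker_meet x z : x != 0 -> q x = 0 -> q z = 0 -> polar q x z = 0 ->
  exists s, [/\ s != 0, s \in hat_ker x & s \in hat_ker z].
Proof.
move=> x0 qx qz xz.
have s0 : vpick (hat_ker x) != 0 by rewrite vpick0 -dimv_eq0 dim_hat_ker.
have sx : vpick (hat_ker x) \in hat_ker x by apply: memv_pick.
move: (vpick _) s0 sx => s s0 sx.
have [zs|zs] := eqVneq (hat z *m s) 0; first by exists s; split=> //; apply/hat_kerP.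
exists (hat z *m s); split=> //; apply/hat_kerP.
  by rewrite hat_swap (hat_kerP _ _ sx) xz mulr0 scale0r mulmx0 addr0.
by rewrite mulmxA hat_sq qz mulr0 raddf0 mul0mx.
Qed.

(** For [Z = <x, z>] the pure spinors are the intersection of the two distinct
    planes attached to [x] and [z], and these meet. *)
Lemma dim_spin_embedding Z x : ts_space q 2 Z -> x \in Z -> x != 0 ->
  \dim (spin_embedding q rho Z) = 1%N.
Proof.
move=> [dZ tsZ] xZ x0; have [z fr ZE] := dimv2_basis dZ xZ x0.
have zZ : z \in Z by rewrite ZE memv_span // !inE eqxx orbT.
have qx := tsZ _ xZ; have qz := tsZ _ zZ.
have xz := singular_polar0 tsZ xZ zZ.
have spinE : spin_embedding q rho Z = (hat_ker x :&: hat_ker z)%VS.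
  apply/vspaceP => s; apply/idP/memv_capP => [/spin_embeddingP sZ|].
    by split; apply/hat_kerP/sZ.
  case=> /hat_kerP xs /hat_kerP zs; apply/spin_embeddingP => v.
  rewrite ZE => /memv_span2[[a b] /= ->].
  by rewrite linearD !linearZ /= mulmxDl -!scalemxAl xs zs !scaler0 addr0.
have dcap : (0 < \dim (hat_ker x :&: hat_ker z))%N.
  have [s [s0 sx sz]] := hat_ker_meet x0 qx qz xz.
  rewrite lt0n dimv_eq0; apply: contraNneq s0 => c0.
  by rewrite -memv0 -c0 memv_cap sx sz.
apply/eqP; rewrite spinE eqn_leq dcap andbT -ltnS.
have := dimv_leqif_sup (capvSl (hat_ker x) (hat_ker z)).
rewrite dim_hat_ker // => leq2; rewrite (ltn_leqif leq2) subv_cap subvv /=.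
exact: hat_ker_not_sub.
Qed.

(** Every spinor [s] of the plane of [x] is reached: the vectors that kill [s]
    form a totally singular space [M], and [M] has dimension 2 since the
    4-dimensional [x^perp] sends [s] into the 2-dimensional kernel of [x]. *)
Lemma spin_embedding_line x : x != 0 -> q x = 0 ->
  spin_embedding q rho @` line_at q <[x]> = proj_points (hat_ker x).
Proof.
move=> x0 qx; apply/seteqP; split=> [_ [Z [tsZ xZ] <-]|p [dp px]].
  split; first by apply: (dim_spin_embedding tsZ _ x0); rewrite memvE.
  apply/subvP => s /spin_embeddingP sZ.
  by apply/hat_kerP/sZ; rewrite memvE.
have [s s0 pE] := dimv1P dp.
have sx : s \in hat_ker x by rewrite memvE -pE.
have [f fE] : exists f : 'Hom(V, 'cV[F]_4), forall v, f v = hat v *m s.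
  by apply: linear_lfun => k u v; rewrite linearP mulmxDl -scalemxAl.
have [g gE] : exists g : 'Hom(V, F^o), forall v, g v = polar q x v.
  by apply: linear_lfun => k u v; rewrite polarDr // polarZr.
pose M := lker f.
have tsM : totally_singular q M.
  move=> v; rewrite memv_ker fE => /eqP vs.
  have := congr1 (mulmx^~ s) (hat_sq v).
  rewrite -mulmxA vs mulmx0 mul_scalar_mx => /esym/eqP.
  by rewrite scaler_eq0 (negbTE s0) orbF mulf_eq0 (negbTE qr_neq0) => /eqP.
have dM : \dim M = 2%N.
  apply/eqP; rewrite eqn_leq (q_witt.2 M tsM) /=.
  have dperp : (4 <= \dim (lker g))%N.
    have := limg_ker_dim g fullv; rewrite capfv dimV => dg.
    rewrite -(leq_add2r 1) [X in (X <= _)%N](esym dg) leq_add2l.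
    apply: leq_trans (dimvS (subvf _)) _.
    by rewrite dimvf.
  have fperp : (f @: lker g <= hat_ker x)%VS.
    apply/subvP => _ /memv_imgP[v vg ->]; rewrite fE; apply/hat_kerP.
    have xv : polar q x v = 0 by move: vg; rewrite memv_ker gE => /eqP.
    by rewrite hat_swap (hat_kerP _ _ sx) xv mulr0 scale0r mulmx0 addr0.
  have := limg_ker_dim f (lker g).
  have := dimvS fperp; rewrite dim_hat_ker // => le2 dE.
  have le := dimvS (capvSr (lker g) (lker f)).
  apply: leq_trans le; rewrite -(leq_add2r 2); apply: leq_trans dperp _.
  by rewrite -dE leq_add2l.
have xM : x \in M by rewrite memv_ker fE; apply/eqP/hat_kerP.
exists M; first by split; [split|rewrite -memvE].
apply: esym; apply: dimv1_eq => //; first exact: (dim_spin_embedding (conj dM tsM) xM x0).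
rewrite pE -memvE; apply/spin_embeddingP => v.
by rewrite memv_ker fE => /eqP.
Qed.

Lemma vs_embedding_line x : x != 0 -> q x = 0 ->
  vs_embedding q rho @` line_at q <[x]> = conic (hat_ker x).
Proof.
move=> x0 qx; rewrite /conic -spin_embedding_line //.
by rewrite image_comp.
Qed.

End SpinModule.

(** * The nuclei depend linearly on the singular points *)

Section SpinBivectors.
Variables (F : fieldType) (char2 : 2%N \in [pchar F]) (V : vectType F).
Variables (q : V -> F) (q_quad : quadratic_form q).
Hypotheses (dimV : \dim (fullv : {vspace V}) = 5%N) (q_ns : nonsingular q).
Hypothesis q_witt : witt_index q 2.
Variables (rho : {bilinear V -> V -> 'M[F]_4}) (rho_spin : spin_module q rho).
Variables (e1 e2 f1 f2 r : V).
Hypothesis fr : frame q e1 e2 f1 f2 r.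

Local Notation hat := (hat rho r).

(** [J] is, up to a scalar, the inverse of the invariant symplectic form on the
    spin module, for which all [hat v] are self-adjoint. In the basis
    [s, f1 s, f2 s, f1 f2 s] built from a pure spinor [s] of [<e1, e2>] it is
    [s /\ f1 f2 s + f1 s /\ f2 s]. *)
Lemma spin_bivector : exists2 J : 'M[F]_4, J != 0 & forall v, alternating (hat v *m J).
Proof.
have [spanV qe1 qe2 qf1 qf2 e12 f12 e1f1 e2f2 e1f2 e2f1 e10 qr rad] := fr.
have [s [s0 /hat_kerP s_e1 /hat_kerP s_e2]] :=
  hat_ker_meet char2 q_quad q_ns rho_spin rad qr e10 qe1 qe2 e12.
pose s1 := s; pose s2 := hat f1 *m s; pose s3 := hat f2 *m s.
pose s4 := hat f1 *m (hat f2 *m s).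
have swap := hat_swap char2 rho_spin rad.
have sq v (u : 'cV[F]_4) : q v = 0 -> hat v *m (hat v *m u) = 0.
  by move=> qv; rewrite mulmxA (hat_sq char2 rho_spin rad) qv mulr0 raddf0 mul0mx.
have E1 : [/\ hat e1 *m s1 = 0, hat e1 *m s2 = q r *: s1, hat e1 *m s3 = 0
    & hat e1 *m s4 = q r *: s3].
  rewrite /s1 /s2 /s3 /s4; split=> //.
  - by rewrite swap s_e1 e1f1 mulr1 mulmx0 addr0.
  - by rewrite swap s_e1 e1f2 mulr0 scale0r mulmx0 addr0.
  - by rewrite swap e1f1 mulr1 (swap e1 f2) s_e1 e1f2 mulr0 scale0r !mulmx0 addr0 mulmx0 addr0.
have E2 : [/\ hat e2 *m s1 = 0, hat e2 *m s2 = 0, hat e2 *m s3 = q r *: s1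
    & hat e2 *m s4 = q r *: s2].
  rewrite /s1 /s2 /s3 /s4; split=> //.
  - by rewrite swap s_e2 e2f1 mulr0 scale0r mulmx0 addr0.
  - by rewrite swap s_e2 e2f2 mulr1 mulmx0 addr0.
  - rewrite swap e2f1 mulr0 scale0r add0r (swap e2 f2) s_e2 e2f2 mulr1 mulmx0 addr0.
    by rewrite -scalemxAr.
have F1 : [/\ hat f1 *m s1 = s2, hat f1 *m s2 = 0, hat f1 *m s3 = s4
    & hat f1 *m s4 = 0].
  by rewrite /s1 /s2 /s3 /s4; split; rewrite ?sq.
have F2 : [/\ hat f2 *m s1 = s3, hat f2 *m s2 = s4, hat f2 *m s3 = 0
    & hat f2 *m s4 = 0].
  rewrite /s1 /s2 /s3 /s4; split; rewrite ?sq //.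
    by rewrite swap polarC f12 mulr0 scale0r add0r.
  by rewrite swap sq // polarC f12 mulr0 scale0r mulmx0 addr0.
pose J := wedge s1 s4 + wedge s2 s3.
case: E1 E2 F1 F2 => [e1s1 e1s2 e1s3 e1s4] [e2s1 e2s2 e2s3 e2s4].
move=> [f1s1 f1s2 f1s3 f1s4] [f2s1 f2s2 f2s3 f2s4].
have e1J : hat e1 *m J = q r *: wedge s1 s3.
  rewrite mulmxDr !mulmx_wedge e1s1 e1s2 e1s3 e1s4 !mul0mx add0r addr0 -!scalemxAl.
  by rewrite -scalerDr addrC.
exists J => [|v].
  (* [e2 e1] sends [J] to a nonzero multiple of [s *m s^T]. *)
  apply: contraNneq s0 => J0; rewrite -(veronese_eq0 s).
  have : hat e2 *m (hat e1 *m J) = 0 by rewrite J0 !mulmx0.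
  rewrite e1J -scalemxAr mulmx_wedge e2s1 e2s3 mul0mx add0r -scalemxAl => /eqP.
  by rewrite !scaler_eq0 (negbTE qr) /= veroneseE => /eqP ->; rewrite linear0.
have : v \in <<[:: e1; e2; f1; f2; r]>>%VS by rewrite spanV memvf.
move: v; apply: (@span_ind _ _ (fun v => alternating (hat v *m J))).
- by rewrite linear0 mul0mx; exists 0; rewrite trmx0 addr0.
- by move=> k x y altx alty; rewrite linearP mulmxDl -scalemxAl; apply: alternating_comb.
have altZ k A : alternating A -> alternating (k *: A).
  by move=> [T ->]; exists (k *: T); rewrite linearZ scalerDr.
move=> v; rewrite !inE => /orP[/eqP->|/or4P[] /eqP->].
- by rewrite e1J; apply/altZ/alternating_wedge.
- suff -> : hat e2 *m J = q r *: wedge s1 s2 by apply/altZ/alternating_wedge.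
  rewrite mulmxDr !mulmx_wedge e2s1 e2s2 e2s3 e2s4 !mul0mx !add0r -!scalemxAl.
  by rewrite -scalerDr addrC.
- suff -> : hat f1 *m J = wedge s2 s4 by apply: alternating_wedge.
  by rewrite mulmxDr !mulmx_wedge f1s1 f1s2 f1s3 f1s4 !mul0mx add0r addr0.
- suff -> : hat f2 *m J = wedge s3 s4 by apply: alternating_wedge.
  by rewrite mulmxDr !mulmx_wedge f2s1 f2s2 f2s3 f2s4 !mul0mx !addr0.
rewrite (hat_rad rho_spin) mul_scalar_mx; apply: altZ.
rewrite /J -[wedge s1 s4]scale1r; apply: alternating_comb; exact: alternating_wedge.
Qed.

(** For singular [x] the alternating matrix [hat x *m J] has its columns in the
    kernel plane of [x], so it is the bivector of that plane, whose upper
    triangle is the nucleus. The dependence on [x] is visibly linear. *)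
Lemma nucleus_map : exists g : 'Hom(V, ver_space F), lker g == 0%VS /\
  forall x, x != 0 -> q x = 0 -> conic_nucleus q rho <[x]>%VS = <[g x]>%VS.
Proof.
have [_ _ _ _ _ _ _ _ _ _ _ _ qr rad] := fr.
have [J J0 altJ] := spin_bivector.
have [g gE] : exists g : 'Hom(V, ver_space F), forall v, g v = upper (hat v *m J).
  by apply: linear_lfun => k u v; rewrite linearP mulmxDl -scalemxAl linearP.
have symJ : J^T = J.
  have := alternating_tr (altJ r).
  by rewrite (hat_rad rho_spin) mul_scalar_mx linearZ => /(scalerI qr).
(* If [hat v *m J = 0], moving [hat v] across [J] in the Clifford relations
   shows that [v] is a singular vector of the radical. *)
have g_inj v : g v = 0 -> v = 0.
  rewrite gE => /upper_inj_sym vJ; apply/eqP/negPn/negP => v0.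
  have {}vJ : hat v *m J = 0 by apply: vJ; rewrite alternating_tr.
  have vw w : polar q v w = 0.
    have := congr1 (mulmx^~ J) (hat_anticomm char2 rho_spin rad v w).
    rewrite mulmxDl -!mulmxA vJ mulmx0 addr0.
    rewrite -[hat w *m J]alternating_tr // trmx_mul symJ mulmxA vJ mul0mx.
    rewrite mul_scalar_mx => /esym/eqP.
    by rewrite scaler_eq0 (negbTE J0) orbF mulf_eq0 (negbTE qr) => /eqP.
  have := congr1 (mulmx^~ J) (hat_sq char2 rho_spin rad v).
  rewrite -mulmxA vJ mulmx0 mul_scalar_mx => /esym/eqP.
  by rewrite scaler_eq0 (negbTE J0) orbF mulf_eq0 (negbTE qr) (negbTE (q_ns v0 vw)).
exists g; split; first by apply/lker0P => u v uv; apply/eqP; rewrite -subr_eq0;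
  apply/eqP/g_inj; rewrite linearB /= uv subrr.
move=> x x0 qx; rewrite /conic_nucleus.
rewrite (vs_embedding_line char2 q_quad dimV q_ns q_witt rho_spin rad qr x0 qx).
have dK := dim_hat_ker char2 q_quad q_ns rho_spin rad qr x0 qx.
have s0 : vpick (hat_ker rho r x) != 0 by rewrite vpick0 -dimv_eq0 dK.
have [t st KE] := dimv2_basis dK (memv_pick _) s0.
rewrite {1}KE nucleus_conic //.
have [k gxE] : exists k, hat x *m J = k *: wedge (vpick (hat_ker rho r x)) t.
  apply: alternating_plane => // j; rewrite -KE; apply/hat_kerP.
  by rewrite mulmx_col mulmxA (hat_sq char2 rho_spin rad) qx mulr0 raddf0 mul0mx col0.
have k0 : k != 0.
  by apply: contraNneq x0 => k0; apply/eqP/g_inj; rewrite gE gxE k0 scale0r linear0.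
by rewrite gE gxE linearZ vlineZ.
Qed.

End SpinBivectors.

(** * Linear images of the natural embedding *)

Section LinearImage.
Variables (F : fieldType) (char2 : 2%N \in [pchar F]) (V W : vectType F).
Variables (q : V -> F) (q_quad : quadratic_form q) (q_ns : nonsingular q).
Hypothesis q_witt : witt_index q 2.
Variables (h : 'Hom(V, W)) (eps : carrier (Delta1 q) -> {vspace W}).
Hypothesis eps_h : forall X, points (Delta1 q) X -> eps X = (h @: X)%VS.

Lemma span_linear_image : span_of (eps @` points (Delta1 q)) = limg h.
Proof.
apply: is_span_uniq; split=> [p [X tsX <-]|U HU].
  by rewrite eps_h // limgS ?subvf.
have preU : (h @^-1: U)%VS = fullv.
  apply: (singular_span char2 q_quad q_ns q_witt) => v qv.
  have [->|v0] := eqVneq v 0; first exact: mem0v.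
  have tsv : points (Delta1 q) <[v]>%VS by apply/(ts_pointP q_quad); exists v.
  rewrite -memv_preim memvE -limg_line -eps_h //; apply: HU.
  by exists <[v]>%VS.
by apply/subvP => _ /memv_imgP[v _ ->]; rewrite memv_preim preU memvf.
Qed.

Hypotheses (h_inj : lker h == 0%VS) (h_surj : limg h = fullv).

Lemma embedding_of_linear_image : projective_embedding eps.
Proof.
have dimh U : \dim (h @: U) = \dim U.
  by apply: limg_dim_eq; rewrite (eqP h_inj) capv0.
have subh U U' : (h @: U <= h @: U')%VS = (U <= U')%VS by rewrite limg_ker0.
split.
- by move=> X tsX; rewrite eps_h //; split; [rewrite dimh; case: tsX|apply: subvf].
- move=> X Y /set_mem tsX /set_mem tsY; rewrite !eps_h // => /eqP.
  by rewrite eq_limg_ker0 // => /eqP.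
- move=> _ [Z [dZ tsZ] ->]; exists (h @: Z)%VS; first by rewrite dimh.
  apply/seteqP; split=> [_ [X [tsX XZ] <-]|p [dp pZ]].
    by rewrite eps_h //; split; [rewrite dimh; case: tsX|rewrite subh].
  have pE : (h @: (h @^-1: p))%VS = p.
    by apply: lpreimK; rewrite h_surj subvf.
  have subZ : (h @^-1: p <= Z)%VS by rewrite -subh pE.
  have tsp : ts_space q 1 (h @^-1: p)%VS.
    split; first by rewrite -dimh pE.
    by move=> v /(subvP subZ); apply: tsZ.
  by exists (h @^-1: p)%VS => //; rewrite eps_h.
by rewrite span_linear_image.
Qed.

Lemma isomorphic_of_linear_image : isomorphic_embeddings eps (natural_embedding q).
Proof.
exists (h^-1)%VF.
  split.
    exists h; last by move=> v; rewrite lker0_lfunK.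
    by move=> w; rewrite limg_lfunVK // h_surj memvf.
  exists idfun; first by exists id.
  by move=> k u v /=; rewrite linearP.
move=> X tsX; rewrite eps_h // /natural_embedding.
apply/seteqP; split=> [v /= vX|_ /= [_ /memv_imgP[v vX ->] <-]].
  by exists (h v); rewrite /= ?memv_img // lker0_lfunK.
by rewrite lker0_lfunK.
Qed.

End LinearImage.

(** * The embedding by nuclei *)

Lemma corestrict_line (F : fieldType) (W : vectType F) (N : {vspace W})
    (w : subvs_of N) : corestrict N <[vsval w]>%VS = <[w]>%VS.
Proof.
apply/vspaceP => u; rewrite -memv_preim lfunE.
apply/vlineP/vlineP => [[k uE]|[k ->]]; exists k; last by rewrite linearZ.
by apply: subvs_inj; rewrite linearZ.
Qed.

Theorem lemma2 (F : fieldType) (char2 : 2%N \in [pchar F])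
  (V : vectType F) (dimV : \dim (fullv : {vspace V}) = 5%N)
  (q : V -> F) (q_quad : quadratic_form q) (q_ns : nonsingular q)
  (q_witt : witt_index q 2)
  (rho : {bilinear V -> V -> 'M[F]_4}) (rho_spin : spin_module q rho) :
  projective_embedding (iota1 q rho) /\
  isomorphic_embeddings (iota1 q rho) (natural_embedding q).
Proof.
have [e1 [e2 [f1 [f2 [r fr]]]]] := frame_exists char2 q_quad dimV q_ns q_witt.
have [g [g_inj nucE]] := nucleus_map char2 q_quad dimV q_ns q_witt rho_spin fr.
have nuc_img X : points (Delta1 q) X -> conic_nucleus q rho X = (g @: X)%VS.
  by move=> /(ts_pointP q_quad)[x [x0 qx ->]]; rewrite nucE // limg_line.
have NE : nuclei_span q rho = limg g.
  exact: (span_linear_image char2 q_quad q_ns q_witt nuc_img).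
rewrite /iota1; move: (nuclei_span q rho) NE => N NE.
have gN v : g v \in N by rewrite NE memv_img ?memvf.
(* [h] is [g] with its codomain restricted to its image [N]. *)
have [h hE] : exists h : 'Hom(V, subvs_of N), forall v, h v = vsproj N (g v).
  by apply: linear_lfun => k u v; rewrite !linearP.
have valh v : vsval (h v) = g v by rewrite hE vsprojK.
have h_inj : lker h == 0%VS.
  by apply/lker0P => u v uv; move/lker0P: g_inj; apply; rewrite -!valh uv.
have h_surj : limg h = fullv.
  apply/eqP; rewrite eqEsubv subvf; apply/subvP => w _.
  have : vsval w \in limg g by rewrite -NE subvsP.
  case/memv_imgP => v _ wE; have -> : w = h v by apply: subvs_inj; rewrite valh.
  by rewrite memv_img ?memvf.
have epsE X : points (Delta1 q) X ->
    corestrict N (conic_nucleus q rho X) = (h @: X)%VS.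
  move=> /(ts_pointP q_quad)[x [x0 qx ->]].
  by rewrite nucE // limg_line -valh corestrict_line.
split.
  exact: (embedding_of_linear_image char2 q_quad q_ns q_witt epsE h_inj h_surj).
exact: (isomorphic_of_linear_image epsE h_inj h_surj).
Qed.
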